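(* Let $\mathbf U\in\mathcal G$. Then: (i) (Scaling invariance) $\lambda\mathbf U\in\mathcal G$ for all scalars $\lambda>0$. (ii) (Orthogonal invariance) $\mathbf T\mathbf U\in\mathcal G$, where $\mathbf T=\mathrm{diag}\{1,\mathbf T_d,1\}$ and $\mathbf T_d$ is any orthogonal matrix of size $d$. (iii) (Lax–Friedrichs splitting) For every $i=1,\dots,d$, $\mathbf U\pm c^{-1}\mathbf F_i(\mathbf U)\in\mathcal G\cup\partial\mathcal G$, and $\mathbf U\pm\alpha^{-1}\mathbf F_i(\mathbf U)\in\mathcal G$ for any $\alpha>c=1$, where $\partial\mathcal G$ denotes the boundary of $\mathcal G$.
   Context: Let $d\in\{1,2,3\}$, and take units in which the speed of light is $c=1$. The equation of state is a function $e=e(p,\rho)$ (specific internal energy) of pressure $p>0$ and rest-mass density $\rho>0$; the specific enthalpy is $h(p,\rho)=1+e(p,\rho)+p/\rho$. To primitive variables $(\rho,\mathbf v,p)$ with velocity $\mathbf v=(v_1,\dots,v_d)\in\mathbb R^d$, $v=|\mathbf v|<1$, and Lorentz factor $W=(1-v^2)^{-1/2}$ corresponds the conservative vector $\mathbf U=(D,\mathbf m,E)^{\rm T}\in\mathbb R^{d+2}$ given by $$D=\rho W,\qquad \mathbf m=\rho hW^2\mathbf v,\qquad E=\rho hW^2-p .$$ The set of admissible states is $$\mathcal G=\{\mathbf U=(D,\mathbf m,E)^{\rm T}:\ \rho(\mathbf U)>0,\ p(\mathbf U)>0,\ e(\mathbf U)>0,\ v(\mathbf U)<1\},$$ where $\rho(\mathbf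 U),p(\mathbf U),e(\mathbf U),v(\mathbf U)$ are the primitive quantities determined by $\mathbf U$ through these relations; that is, $\mathbf U\in\mathcal G$ means that there is exactly one triple $(\rho,\mathbf v,p)$ with $\rho>0$, $|\mathbf v|<1$, $p>0$ satisfying the three relations, and that $e(p,\rho)>0$ for this triple. For $\mathbf U\in\mathcal G$ with these primitive variables the fluxes are $$\mathbf F_i(\mathbf U)=(Dv_i,\ v_i\mathbf m+p\,\mathbf e_i,\ m_i)^{\rm T},\quad i=1,\dots,d,$$ with $\mathbf e_i$ the $i$-th row of the identity matrix of order $d$. Standing assumptions on the equation of state: $e$ is continuously differentiable on $\mathbb R^+\times\mathbb R^+$; for all $p,\rho>0$, $h(p,\rho)\ge\sqrt{1+p^2/\rho^2}+p/\rho$ and $h\big(\frac1\rho-\frac{\partial h}{\partial p}\big)<\frac{\partial h}{\partial\rho}<0$ (with $h=h(p,\rho)$); and for every fixed $\rho>0$, $\lim_{p\to0^+}e(p,\rho)=0$ and $\lim_{p\to+\infty}e(p,\rho)=+\infty$. *)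

(* Defs.v *)
From mathcomp Require Import all_boot all_order all_algebra.
From mathcomp Require Import all_classical all_reals all_analysis.

Set Implicit Arguments.
Unset Strict Implicit.
Unset Printing Implicit Defensive.

Import Order.TTheory GRing.Theory Num.Theory.
Import numFieldNormedType.Exports.

Local Open Scope classical_set_scope.
Local Open Scope ring_scope.

(* An equation of state is a total function [e p rho]; its values outside
   [0 < p], [0 < rho] affect neither the assumptions nor the admissible set. *)

Definition enthalpy (R : realType) (e : R -> R -> R) (p rho : R) : R :=
  1 + e p rho + p / rho.

Definition C1_on_quadrant (R : realType) (e : R -> R -> R) : Prop :=
  let f := fun x : R * R => e x.1 x.2 in
  forall p rho : R, 0 < p -> 0 < rho ->
    differentiable f (p, rho) /\
    forall u : R * R, {for (p, rho), continuous (fun x => 'D_u f x)}.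

Record eos_assumptions (R : realType) (e : R -> R -> R) : Prop :=
  EosAssumptions {
    eos_C1 : C1_on_quadrant e;
    eos_enthalpy_ge : forall p rho : R, 0 < p -> 0 < rho ->
      Num.sqrt (1 + p ^+ 2 / rho ^+ 2) + p / rho <= enthalpy e p rho;
    eos_derivatives : forall p rho : R, 0 < p -> 0 < rho ->
      let h := enthalpy e p rho in
      let h_p := derive1 (fun q => enthalpy e q rho) p in
      let h_rho := derive1 (fun r => enthalpy e p r) rho in
      h * (1 / rho - h_p) < h_rho /\ h_rho < 0;
    eos_lim0 : forall rho : R, 0 < rho ->
      e p rho @[p --> 0^'+] --> (0 : R);
    eos_limy : forall rho : R, 0 < rho ->
      e p rho @[p --> +oo%R] --> +oo%R
  }.

(* Not [`|v|], which is the sup norm on matrices. *)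
Definition euclidean_norm (R : realType) (d : nat) (v : 'cV[R]_d) : R :=
  Num.sqrt (\sum_(i < d) v i 0 ^+ 2).

Definition lorentz (R : realType) (d : nat) (v : 'cV[R]_d) : R :=
  (Num.sqrt (1 - euclidean_norm v ^+ 2))^-1.

(* R^(d+2), split so that (D, m, E) are blocks *)
Notation state R d := 'cV[R]_(1 + (d + 1)).

Definition mkstate (R : realType) (d : nat) (D : R) (m : 'cV[R]_d) (E : R) :
    state R d :=
  col_mx D%:M (col_mx m E%:M).

Definition mass (R : realType) (d : nat) (U : state R d) : R :=
  usubmx U 0 0.

Definition momentum (R : realType) (d : nat) (U : state R d) : 'cV[R]_d :=
  usubmx (dsubmx U).

(* [(rho, v, p)] is a physical preimage of [U] *)
Definition is_primitive (R : realType) (d : nat) (e : R -> R -> R)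
    (U : state R d) (w : R * 'cV[R]_d * R) : Prop :=
  let: (rho, v, p) := w in
  let h := enthalpy e p rho in
  let W := lorentz v in
  [/\ 0 < rho, euclidean_norm v < 1, 0 < p &
      U = mkstate (rho * W) ((rho * h * W ^+ 2) *: v) (rho * h * W ^+ 2 - p)].

(* These are meaningful when [U] has exactly one physical preimage;
   otherwise an arbitrary triple is chosen. *)
Definition primitive (R : realType) (d : nat) (e : R -> R -> R)
    (U : state R d) : R * 'cV[R]_d * R :=
  xget (0, 0, 0) [set w | is_primitive e U w].

Definition density (R : realType) (d : nat) (e : R -> R -> R)
    (U : state R d) : R := (primitive e U).1.1.

Definition velocity (R : realType) (d : nat) (e : R -> R -> R)
    (U : state R d) : 'cV[R]_d := (primitive e U).1.2.

Definition pressure (R : realType) (d : nat) (e : R -> R -> R)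
    (U : state R d) : R := (primitive e U).2.

(* [is_primitive] already contains rho > 0, p > 0 and |v| < 1. *)
Definition admissible (R : realType) (d : nat) (e : R -> R -> R) :
    set (state R d) :=
  [set U | (exists! w, is_primitive e U w) /\
           0 < e (pressure e U) (density e U)].
Arguments admissible {R} d e.

Definition flux (R : realType) (d : nat) (e : R -> R -> R) (i : 'I_d)
    (U : state R d) : state R d :=
  let v_i := velocity e U i 0 in
  mkstate (mass U * v_i)
          (v_i *: momentum U + pressure e U *: (row i 1%:M)^T)
          (momentum U i 0).

Definition boundary (T : topologicalType) (A : set T) : set T :=
  closure A `\` interior A.

Definition orthogonal_matrix (R : realType) (d : nat) (T : 'M[R]_d) : Prop :=
  T *m T^T = 1%:M.

Definition diag_1T1 (R : realType) (d : nat) (Td : 'M[R]_d) :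
    'M[R]_(1 + (d + 1)) :=
  block_mx 1%:M 0 0 (block_mx Td 0 0 1%:M).

(* Main.v *)
Require Import Defs.
From mathcomp Require Import all_boot all_order all_algebra.
From mathcomp Require Import all_classical all_reals all_analysis.
From mathcomp Require Import ring lra.
Import Order.TTheory GRing.Theory Num.Theory.
Import numFieldNormedType.Exports.
Local Open Scope classical_set_scope.
Local Open Scope ring_scope.

Set Implicit Arguments.
Unset Strict Implicit.
Unset Printing Implicit Defensive.

(** The admissible set is an explicit convex cone, the same for every equation
    of state: $(D, m, E)$ is admissible if and only if $D > 0$, $E > 0$ and
    $D^2 + |m|^2 < E^2$ ([admissible_mkstate]).  Scaling and orthogonal
    invariance are then immediate.

    That admissible states lie in the cone is algebra: the assumed lower bound
    on $h$ says $(\rho h - p)^2 \ge \rho^2 + p^2$, and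
    $E^2 - D^2 - |m|^2 = W^2 (\rho^2 h^2 - 2 \rho h p - \rho^2) + p^2$.
    It also forces $e > 0$, so that only the existence of a unique preimage
    matters in the definition.

    Conversely, given a point of the cone, velocity and density are explicit
    functions of the pressure, $v = m / (E + p)$ and $\rho(p) = D / W$, and the
    three relations reduce to the equation $D h(p, \rho(p)) = s(p)$ with
    $s(p) = \sqrt{(E + p)^2 - |m|^2}$ ([is_primitiveE]).  A solution exists by the
    intermediate value theorem, from the limits of $e$ and the monotonicity of
    $h$ in $\rho$ ([pressure_exists]).  It is unique because $h / s$ has
    positive derivative wherever it is at most $1 / D$, a consequence of
    the inequalities on the partial derivatives of $h$
    ([enthalpy_quotient_increasing], [crossing_unique]).

    For the splitting, put $k = 1 + \theta v_i > 0$.  The state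
    $U + \theta F_i(U)$ has mass $k D$, energy $k \rho h W^2 - p$ and momentum
    $k m + \theta p e_i$, and for this state $E^2 - D^2 - |m|^2$ equals
    $k^2 W^2 (\rho^2 h^2 - 2 \rho h p - \rho^2) +
    p^2 (1 - \theta^2)$ ([cone_inequality], [admissible_add_flux]).  So it is
    admissible for $|\theta| < 1$, and for $|\theta| = 1$ it is a limit of
    admissible states. *)

(** * One-variable calculus *)

(** The hypotheses on the equation of state speak of partial derivatives,
    whereas the pressure equation is differentiated along the curve
    $(p, \rho(p))$; this chain rule connects the two. *)
Lemma is_derive_curve (R : realType) (f : R -> R -> R) (a b : R -> R)
    (t a' b' : R) :
  differentiable (fun x : R * R => f x.1 x.2) (a t, b t) ->
  is_derive t 1 a a' -> is_derive t 1 b b' ->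
  is_derive t 1 (fun u => f (a u) (b u))
    (a' * derive1 (fun q => f q (b t)) (a t) +
     b' * derive1 (fun r => f (a t) r) (b t)).
Proof.
move=> df da db.
(* The coordinate lines through the point are curves too, so one statement
   for a general curve gives both partial derivatives. *)
have curve (c1 c2 : R -> R) (u c1' c2' : R) : c1 u = a t -> c2 u = b t ->
    is_derive u 1 c1 c1' -> is_derive u 1 c2 c2' ->
    is_derive u 1 (fun z => f (c1 z) (c2 z))
      ('d (fun x : R * R => f x.1 x.2) (a t, b t) (c1', c2')).
  move=> e1 e2 [dc1 ec1] [dc2 ec2].
  have /derivable1_diffP d1 := dc1.
  have /derivable1_diffP d2 := dc2.
  have dp : differentiable (fun z => (c1 z, c2 z)) u.
    exact: differentiable_pair.
  have df' : differentiable (fun x : R * R => f x.1 x.2) (c1 u, c2 u).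
    by rewrite e1 e2.
  have dfc : differentiable ((fun x : R * R => f x.1 x.2) \o (fun z => (c1 z, c2 z))) u.
    exact: differentiable_comp.
  apply: DeriveDef; first exact/derivable1_diffP.
  transitivity ('d ((fun x : R * R => f x.1 x.2) \o (fun z => (c1 z, c2 z))) u 1).
    by rewrite -deriveE.
  rewrite (diff_comp dp df') /= e1 e2; congr ('d _ _ _).
  by rewrite diff_pair //= -!deriveE // ec1 ec2.
have dL := curve a b t a' b' erefl erefl da db.
have d1 := curve id (cst (b t)) (a t) 1 0 erefl erefl _ _.
have d2 := curve (cst (a t)) id (b t) 0 1 erefl erefl _ _.
rewrite !derive1E (@derive_val _ _ _ _ _ _ _ (d1 _ _)) (@derive_val _ _ _ _ _ _ _ (d2 _ _)).
suff -> : a' * 'd (fun x : R * R => f x.1 x.2) (a t, b t) (1, 0) +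
          b' * 'd (fun x : R * R => f x.1 x.2) (a t, b t) (0, 1) =
          'd (fun x : R * R => f x.1 x.2) (a t, b t) (a', b') by [].
have -> : (a', b') = a' *: (1, 0) + b' *: (0, 1) :> R * R.
  by congr pair; rewrite /= !scaler0 ?addr0 ?add0r [RHS]mulr1.
by rewrite linearD !linearZ.
Qed.

Lemma is_derive_lt_left (R : realType) (f : R -> R) (c l b : R) :
  is_derive c 1 f l -> 0 < l -> b < c -> exists2 t, b < t < c & f t < f c.
Proof.
move=> [df dl] l0 bc.
have : (h^-1 *: (f (h + c) - f c)) @[h --> 0^'] --> l.
  have := df; rewrite /derivable => /cvg_ex [k kl].
  have <- : k = l.
    rewrite -dl; symmetry; exact: (cvg_lim _ kl).
  have E : (fun h : R => h^-1 *: (f (h + c) - f c)) =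
      (fun h : R => h^-1 *: ((f \o shift c) (h *: (1:R)) - f c)).
    by apply/funext => h /=; rewrite [h *: _]mulr1.
  by rewrite E.
move=> /cvgr_gt /(_ _ l0); rewrite /= => nr.
have nr2 : \forall h \near 0^'-, 0 < h^-1 *: (f (h + c) - f c).
  case: nr => e e0 H; exists e => // x xe x0; apply: H => //.
  by rewrite lt_eqF.
have := nr2.
near (0 : R)^'- => h => _.
have h0 : h < 0 by near: h; exact: nbhs_left_lt.
exists (h + c).
  rewrite gtrDr h0 andbT -ltrBlDr; near: h; apply: nbhs_left_gt.
  by rewrite subr_lt0.
have : 0 < h^-1 *: (f (h + c) - f c) by near: h.
by rewrite [_ *: _]/(_ * _) nmulr_rgt0 ?invr_lt0 // subr_lt0.
Unshelve. all: by end_near.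
Qed.

(** Replaces global monotonicity: the derivative is controlled only below the
    level [k].  A minimum of [f] on [[p, q]] has value at most [k], and it can
    be taken different from [p] because [f p = f q]; a positive derivative
    there contradicts minimality on its left. *)
Lemma crossing_unique (R : realType) (f f' : R -> R) (k p q : R) :
  (forall t, p <= t <= q -> is_derive t 1 f (f' t)) ->
  (forall t, p <= t <= q -> f t <= k -> 0 < f' t) ->
  p < q -> f p = k -> f q = k -> False.
Proof.
move=> df f'0 pq fp fq.
have cf : {within `[p, q], continuous f}.
  apply: derivable_within_continuous => x; rewrite in_itv /= => xpq.
  by have [] := df x xpq.
have [c cpq cmin] := EVT_min (ltW pq) cf.
have {c cpq cmin}[c [pc cq cmin fck]] : exists c, [/\ p < c, c <= q,
    (forall t, t \in `[p, q] -> f c <= f t) & f c <= k].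
  have fck : f c <= k by rewrite -fp; apply: cmin; rewrite in_itv /= lexx ltW.
  move: cpq; rewrite in_itv /= le_eqVlt => /andP[/predU1P[pc|pc] cq].
    exists q; split=> //; last by rewrite fq.
    by move=> t tpq; rewrite fq -fp pc; exact: cmin.
  by exists c; split.
have dc : p <= c <= q by rewrite cq ltW.
have [t /andP[pt tc]] := is_derive_lt_left (df c dc) (f'0 c dc fck) pc.
rewrite ltNge cmin // in_itv /= (ltW pt) /=.
exact: le_trans (ltW tc) cq.
Qed.

(** * Regularity and bounds of the enthalpy *)

Lemma enthalpy_differentiable (R : realType) (e : R -> R -> R) (p rho : R) :
  C1_on_quadrant e -> 0 < p -> 0 < rho ->
  differentiable (fun x : R * R => enthalpy e x.1 x.2) (p, rho).
Proof.
move=> he p0 r0; have [de _] := he p rho p0 r0.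
have d1 : differentiable (fst : R * R -> R) (p, rho).
  by apply: linear_differentiable => x; exact: cvg_fst.
have d2 : differentiable (snd : R * R -> R) (p, rho).
  by apply: linear_differentiable => x; exact: cvg_snd.
apply: differentiableD; first exact: differentiableD.
apply: differentiableM => //; apply: differentiableV => //=.
exact: lt0r_neq0.
Qed.

Lemma enthalpy_decr (R : realType) (e : R -> R -> R) (p r1 r2 : R) :
  eos_assumptions e -> 0 < p -> 0 < r1 -> r1 <= r2 ->
  enthalpy e p r2 <= enthalpy e p r1.
Proof.
move=> he p0 r10; rewrite le_eqVlt => /predU1P[->//|r12].
have dh r : 0 < r -> derivable (enthalpy e p) r 1.
  move=> r0; have := @is_derive_curve R (enthalpy e) (cst p) id r 0 1
    (enthalpy_differentiable (eos_C1 he) p0 r0) _ _.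
  by case=> //.
have pos x : x \in `[r1, r2] -> 0 < x.
  by rewrite in_itv /= => /andP[/(lt_le_trans r10)].
apply/ltW/(@ltr0_derive1_decr R (enthalpy e p) r1 r2) => //.
- move=> x xi; apply: dh; apply: pos; exact: subset_itv_oo_cc xi.
- move=> x xi; have x0 : 0 < x by apply: pos; exact: subset_itv_oo_cc xi.
  by have [] := eos_derivatives he p0 x0.
- by apply: derivable_within_continuous => x /pos; exact: dh.
Qed.

(** The lower bound on the enthalpy freed of its square root.  The last
    inequality is $(\rho h - p)^2 \ge \rho^2 + p^2$, which keeps states in the
    cone; the second one keeps their energy positive. *)
Lemma enthalpy_bounds (R : realType) (e : R -> R -> R) (p rho : R) :
  eos_assumptions e -> 0 < p -> 0 < rho ->
  let H := rho * enthalpy e p rho in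
  [/\ 0 < e p rho, 2 * p < H & rho ^+ 2 + 2 * H * p <= H ^+ 2].
Proof.
move=> he p0 r0 H; have := eos_enthalpy_ge he p0 r0.
have Hh : enthalpy e p rho = H / rho by rewrite /H; field; exact: lt0r_neq0.
rewrite Hh -lerBrDr -mulrBl -expr_div_n.
set s := Num.sqrt _ => sh.
have rn : rho != 0 by exact: lt0r_neq0.
have s2 : s ^+ 2 = 1 + (p / rho) ^+ 2.
  by rewrite sqr_sqrtr // addr_ge0 // sqr_ge0.
have s0 : 0 <= s by exact: sqrtr_ge0.
have q0 : 0 < p / rho by exact: divr_gt0.
have s1 : 1 < s.
  rewrite -(@ltr_pXn2r _ 2) ?nnegrE // s2 expr1n ltrDl.
  by rewrite exprn_gt0.
have sq : p / rho < s.
  rewrite -(@ltr_pXn2r _ 2) ?nnegrE ?(ltW q0) // s2.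
  by rewrite ltrDr.
split.
- have := lt_le_trans s1 sh; rewrite mulrBl -Hh /enthalpy; lra.
- have := lt_le_trans sq sh; rewrite ltr_pM2r ?invr_gt0 //; lra.
- have : s ^+ 2 <= ((H - p) / rho) ^+ 2.
    by rewrite ler_pXn2r ?nnegrE // (le_trans s0).
  rewrite s2 !expr_div_n ler_pdivlMr ?exprn_gt0 // mulrDl mul1r divfK ?expf_neq0 //.
  lra.
Qed.

(** * Recovering the pressure *)

(** The value that $D h$ takes for a physical preimage of $(D, m, E)$ with
    $|m|^2 = M$ and pressure [p]: the relations give $E + p = \rho h W^2$ and
    $v = m / (E + p)$, so this is $(E + p) / W = \rho h W = D h$. *)
Definition scaled_enthalpy (R : realType) (E M p : R) : R :=
  Num.sqrt ((E + p) ^+ 2 - M).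
(** $D / W$, with $v = m / (E + p)$. *)
Definition rest_density (R : realType) (D E M p : R) : R :=
  D * scaled_enthalpy E M p / (E + p).

Section Root.
Context (R : realType).
Variables (e : R -> R -> R) (D E M : R).
Hypotheses (he : eos_assumptions e) (D0 : 0 < D) (E0 : 0 < E) (M0 : 0 <= M)
  (ME : M < E ^+ 2).
Let s := scaled_enthalpy E M.
Let r := rest_density D E M.

Lemma radicand_gt0 (p : R) : 0 <= p -> 0 < (E + p) ^+ 2 - M.
Proof.
move=> p0; have := mulr_ge0 (ltW E0) p0; have := mulr_ge0 p0 p0.
by move: ME; rewrite !expr2; lra.
Qed.

Lemma scaled_enthalpy_gt0 (p : R) : 0 <= p -> 0 < s p.
Proof. by move=> p0; rewrite sqrtr_gt0 radicand_gt0. Qed.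

Lemma scaled_enthalpy_sqr (p : R) : 0 <= p -> s p ^+ 2 = (E + p) ^+ 2 - M.
Proof. by move=> p0; rewrite sqr_sqrtr // ltW // radicand_gt0. Qed.

Lemma rest_density_gt0 (p : R) : 0 <= p -> 0 < r p.
Proof.
move=> p0; rewrite divr_gt0 ?mulr_gt0 ?scaled_enthalpy_gt0 //.
exact: ltr_wpDr.
Qed.

Lemma is_derive_scaled_enthalpy (p : R) : 0 < p ->
  is_derive p 1 s ((E + p) / s p).
Proof.
move=> p0.
have d1 : is_derive p 1 (fun q : R => (E + q) ^+ 2 - M) (2 * (E + p)).
  apply: is_derive_eq.
  rewrite /GRing.scale /=. ring.
have d2 := is_derive1_sqrt (radicand_gt0 (ltW p0)).
have := @is_derive1_comp R Num.sqrt (fun q : R => (E + q) ^+ 2 - M) p _ _ d2 d1.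
move=> df; apply: is_derive_eq df _.
rewrite -[Num.sqrt ((E + p) ^+ 2 - M)]/(s p); have := scaled_enthalpy_gt0 (ltW p0) => /lt0r_neq0 sn.
by field.
Qed.


Lemma is_derive_rest_density (p : R) : 0 < p ->
  is_derive p 1 r (D * M / (s p * (E + p) ^+ 2)).
Proof.
move=> p0.
have sn : s p != 0 by rewrite lt0r_neq0 ?scaled_enthalpy_gt0 // ltW.
have x0 : 0 < E + p by exact: addr_gt0.
have xn : E + p != 0 by exact: lt0r_neq0.
have ds := is_derive_scaled_enthalpy p0.
have dx : is_derive p 1 (fun q : R => E + q) 1.
  by apply: is_derive_eq; rewrite /= add0r [LHS]mulr1.
have dV := is_deriveV xn dx.
have dc : is_derive p 1 (cst D : R -> R) 0 by exact: is_derive_cst.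
have dDs := is_deriveM dc ds.
have := is_deriveM dDs dV; move=> df; apply: is_derive_eq df _.
rewrite /GRing.scale /=.
have M_eq : M = (E + p) ^+ 2 - s p ^+ 2 by rewrite scaled_enthalpy_sqr ?ltW //; ring.
rewrite [in RHS]M_eq -[(_ * s) p]/(D * s p).
by field; rewrite xn.
Qed.

(** A physical pressure solves $F(p) = 1/D$.  The quotient, unlike the
    difference $D h - s$, has a derivative of known sign on a whole sublevel
    set and not just at the roots. *)
Let F (p : R) : R := enthalpy e p (r p) / s p.

Lemma is_derive_enthalpy_quotient (p : R) : 0 < p ->
  is_derive p 1 F
    ((derive1 (fun q => enthalpy e q (r p)) p +
      D * M / (s p * (E + p) ^+ 2) * derive1 (enthalpy e p) (r p)) / s p -
     enthalpy e p (r p) * (E + p) / s p ^+ 3).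
Proof.
move=> p0; have sn : s p != 0 by rewrite lt0r_neq0 ?scaled_enthalpy_gt0 // ltW.
have ds := is_derive_scaled_enthalpy p0.
have dr := is_derive_rest_density p0.
have dh := is_derive_curve
  (enthalpy_differentiable (eos_C1 he) p0 (rest_density_gt0 (ltW p0)))
  (is_derive_id _ _) dr.
have := is_deriveM dh (is_deriveV sn ds); move=> df; apply: is_derive_eq df _.
rewrite /GRing.scale /= mul1r.
by field; rewrite sn lt0r_neq0 ?addr_gt0.
Qed.

(** With $h_p > 1/\rho - h_\rho/h$ the quantity $h s^3 F'$ exceeds
    $h (E + p)(s/D - h) - s^2 h_\rho (1 - h \rho'(p))$.  Below the level $1/D$
    one has $D h \le s$; this makes the first term nonnegative, and it bounds
    $h \rho'(p)$ by $M / (E + p)^2 < 1$, so that the second is positive as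
    $h_\rho < 0$. *)
Lemma enthalpy_quotient_increasing (p : R) : 0 < p -> F p <= D^-1 ->
  0 < (derive1 (fun q => enthalpy e q (r p)) p +
      D * M / (s p * (E + p) ^+ 2) * derive1 (enthalpy e p) (r p)) / s p -
     enthalpy e p (r p) * (E + p) / s p ^+ 3.
Proof.
move=> p0 Fk.
have s0 : 0 < s p by rewrite scaled_enthalpy_gt0 // ltW.
have r0 : 0 < r p by rewrite rest_density_gt0 // ltW.
have x0 : 0 < E + p by exact: addr_gt0.
have [] := eos_derivatives he p0 r0.
have : 0 < enthalpy e p (r p).
  apply: lt_le_trans (eos_enthalpy_ge he p0 r0).
  by apply: ltr_wpDl; [exact: sqrtr_ge0 | exact: divr_gt0].
move: Fk; rewrite /F ler_pdivrMr //.
set h := enthalpy e p (r p); set hp := derive1 _ p; set hr := derive1 _ _.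
rewrite mulrC ler_pdivlMr // => hs h0 hphr hr0.
have xx : (E + p) ^+ 2 = s p ^+ 2 + M.
  by rewrite scaled_enthalpy_sqr ?ltW //; ring.
have rp : 1 / r p = (E + p) / (D * s p).
  by rewrite /r /rest_density -/(s p); field; rewrite !lt0r_neq0.
rewrite rp in hphr.
suff : 0 < h * (s p ^+ 2 * (hp + D * M / (s p * (E + p) ^+ 2) * hr) - h * (E + p)).
  rewrite pmulr_rgt0 // => K.
  have -> : (hp + D * M / (s p * (E + p) ^+ 2) * hr) / s p - h * (E + p) / s p ^+ 3
     = (s p ^+ 2 * (hp + D * M / (s p * (E + p) ^+ 2) * hr) - h * (E + p)) / s p ^+ 3.
    by field; rewrite !lt0r_neq0.
  by rewrite divr_gt0 // exprn_gt0.
have hr1 : h * (D * M / (s p * (E + p) ^+ 2)) < 1.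
  rewrite mulrA ltr_pdivrMr ?mulr_gt0 ?exprn_gt0 // mul1r.
  apply: (@le_lt_trans _ _ (s p * M)).
    by rewrite mulrA ler_wpM2r.
  by rewrite ltr_pM2l // xx ltrDr exprn_gt0.
set k := D * M / _ in hr1 *.
have -> : h * (s p ^+ 2 * (hp + k * hr) - h * (E + p)) =
  s p ^+ 2 * (hr - h * ((E + p) / (D * s p) - hp)) +
  h * (E + p) * (s p / D - h) + s p ^+ 2 * ((- hr) * (1 - h * k)).
  by field; rewrite !lt0r_neq0.
apply: ltr_wpDr.
  apply: mulr_ge0; first exact: sqr_ge0.
  by apply: mulr_ge0; rewrite ?oppr_ge0 ?subr_ge0 ltW.
apply: ltr_wpDr; last by rewrite mulr_gt0 ?exprn_gt0 // subr_gt0.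
by rewrite !mulr_ge0 ?(ltW h0) ?(ltW x0) // subr_ge0 ler_pdivlMr.
Qed.

Lemma pressure_unique (p q : R) : 0 < p -> 0 < q ->
  F p = D^-1 -> F q = D^-1 -> p = q.
Proof.
wlog pq : p q / p < q.
  move=> H p0 q0 Fp Fq; have [pq|qp|//] := ltgtP p q; first exact: H.
  by apply/esym; exact: H.
move=> p0 q0 Fp Fq; exfalso.
have pos (t : R) : p <= t <= q -> 0 < t by case/andP => /(lt_le_trans p0).
apply: (@crossing_unique R F _ D^-1 p q _ _ pq Fp Fq) => t /pos t0.
  exact: is_derive_enthalpy_quotient.
exact: enthalpy_quotient_increasing.
Qed.

Lemma rest_density_ge (p : R) : 0 <= p -> r 0 <= r p.
Proof.
move=> p0; have x0 : 0 < E + p by exact: ltr_wpDr.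
rewrite /r /rest_density addr0 -!/(s _) ler_pdivrMr // mulrAC.
rewrite ler_pdivlMr // -!mulrA ler_pM2l //.
have s0 := scaled_enthalpy_gt0 p0; have s00 := scaled_enthalpy_gt0 (lexx 0).
rewrite -(@ler_pXn2r _ 2) ?nnegrE ?mulr_ge0 ?(ltW s0) ?(ltW s00) ?(ltW x0) ?(ltW E0) //.
rewrite !exprMn !scaled_enthalpy_sqr // addr0.
have : E ^+ 2 <= (E + p) ^+ 2.
  by rewrite ler_pXn2r ?nnegrE ?(ltW x0) ?(ltW E0) // lerDl.
by move=> /(ler_wpM2l M0); lra.
Qed.

Lemma rest_density_le (p : R) : 0 <= p -> r p <= D.
Proof.
move=> p0; have x0 : 0 < E + p by exact: ltr_wpDr.
rewrite ler_pdivrMr // ler_pM2l // -!/(s _).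
have s0 := scaled_enthalpy_gt0 p0.
rewrite -(@ler_pXn2r _ 2) ?nnegrE ?(ltW s0) ?(ltW x0) //.
by rewrite scaled_enthalpy_sqr // lerBlDr lerDl.
Qed.

(** As $h$ decreases in $\rho$, the moving density $\rho(p)$ can be replaced
    by its extreme values [r 0] and [D]; there the limits of [e], which are
    assumed for fixed density only, apply.  Near $p = 0$, $D h$ is at most about
    $D < s(0)$; for large [p], $D h \ge D + D e(p, D) + p > E + p \ge s$. *)
Lemma pressure_exists : D ^+ 2 + M < E ^+ 2 ->
  exists2 p, 0 < p & F p = D^-1.
Proof.
move=> DE.
have s00 := scaled_enthalpy_gt0 (lexx 0).
have r00 : 0 < r 0 by exact: rest_density_gt0.
have Ds0 : D < s 0.
  rewrite -(@ltr_pXn2r _ 2) ?nnegrE ?(ltW s00) ?(ltW D0) //.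
  by rewrite scaled_enthalpy_sqr // addr0 ltrBrDr.
have [p0 p00 Fp0] : exists2 p, 0 < p & F p < D^-1.
  have cv : D * enthalpy e p (r 0) @[p --> 0^'+] --> D * (1 + 0 + 0 / r 0).
    apply: cvgM; first exact: cvg_cst.
    apply: cvgD.
      by apply: cvgD; [exact: cvg_cst | exact: (eos_lim0 he r00)].
    apply: cvgM; last exact: cvg_cst.
    exact: cvg_at_right_filter.
  have : D * (1 + 0 + 0 / r 0) < s 0 by rewrite mul0r !addr0 mulr1.
  move=> /(cvgr_lt _ cv) /= small.
  near (0 : R)^'+ => p.
  have pp : 0 < p by near: p; exact: nbhs_right_gt.
  have sp := scaled_enthalpy_gt0 (ltW pp).
  exists p => //; rewrite ltr_pdivrMr // mulrC ltr_pdivlMr // mulrC.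
  apply: (@le_lt_trans _ _ (D * enthalpy e p (r 0))).
    rewrite ler_pM2l //; apply: enthalpy_decr => //.
    exact: rest_density_ge (ltW pp).
  apply: (@lt_le_trans _ _ (s 0)); first by near: p.
  rewrite -(@ler_pXn2r _ 2) ?nnegrE ?(ltW s00) ?(ltW sp) //.
  rewrite (scaled_enthalpy_sqr (lexx 0)) (scaled_enthalpy_sqr (ltW pp)) addr0 lerD2r.
  rewrite ler_pXn2r ?nnegrE ?(ltW E0) ?addr_ge0 ?(ltW E0) ?(ltW pp) //.
  by rewrite lerDl ltW.
have [p1 p01 Fp1] : exists2 p, p0 < p & D^-1 < F p.
  have /cvgryPgt /(_ (E / D)) := eos_limy he D0 => large.
  near (+oo%R : set_system R) => p.
  have pp : p0 < p by near: p; apply: nbhs_pinfty_gt; exact: num_real.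
  have pg : 0 < p by exact: lt_trans pp.
  have sp := scaled_enthalpy_gt0 (ltW pg).
  exists p => //; rewrite ltr_pdivlMr // mulrC ltr_pdivrMr // mulrC.
  have ep : E < D * e p D by rewrite mulrC -ltr_pdivrMr //; near: p.
  apply: (@lt_le_trans _ _ (D * enthalpy e p D)); last first.
    rewrite ler_pM2l //; apply: enthalpy_decr => //.
      exact: rest_density_gt0 (ltW pg).
    exact: rest_density_le (ltW pg).
  apply: (@le_lt_trans _ _ (E + p)).
    have x0 : 0 <= E + p by rewrite addr_ge0 ?(ltW pg) ?(ltW E0).
    rewrite -(@ler_pXn2r _ 2) ?nnegrE ?(ltW sp) //.
    by rewrite (scaled_enthalpy_sqr (ltW pg)) lerBlDr lerDl.
  have -> : D * enthalpy e p D = D + D * e p D + p.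
    by rewrite /enthalpy; field; exact: lt0r_neq0.
  by rewrite ltrD2r ltr_wpDl ?(ltW D0).
have cF : {within `[p0, p1], continuous F}.
  apply: derivable_within_continuous => x; rewrite in_itv /= => /andP[px _].
  by have [] := is_derive_enthalpy_quotient (lt_le_trans p00 px).
have [] := IVT (ltW p01) cF (v := D^-1).
  by rewrite ge_min (ltW Fp0) le_max (ltW Fp1) orbT.
move=> c; rewrite in_itv /= => /andP[p0c _] Fc.
by exists c => //; exact: lt_le_trans p00 p0c.
Unshelve. all: by end_near.
Qed.

End Root.

(** * States and Euclidean length *)

Definition normsq (R : realType) (d : nat) (v : 'cV[R]_d) : R :=
  \sum_(i < d) v i 0 ^+ 2.

Definition energy (R : realType) (d : nat) (U : state R d) : R :=
  dsubmx (dsubmx U) 0 0.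

Lemma normsq_ge0 (R : realType) (d : nat) (v : 'cV[R]_d) : 0 <= normsq v.
Proof. by apply: sumr_ge0 => i _; exact: sqr_ge0. Qed.

Lemma euclidean_norm_sqr (R : realType) (d : nat) (v : 'cV[R]_d) :
  euclidean_norm v ^+ 2 = normsq v.
Proof. by rewrite sqr_sqrtr // normsq_ge0. Qed.

Lemma euclidean_norm_lt1 (R : realType) (d : nat) (v : 'cV[R]_d) :
  (euclidean_norm v < 1) = (normsq v < 1).
Proof.
by rewrite -euclidean_norm_sqr expr_lt1 // sqrtr_ge0.
Qed.

Lemma normsqZ (R : realType) (d : nat) (a : R) (v : 'cV[R]_d) :
  normsq (a *: v) = a ^+ 2 * normsq v.
Proof.
by rewrite /normsq mulr_sumr; apply: eq_bigr => i _; rewrite mxE exprMn.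
Qed.

Lemma normsq_mulmx (R : realType) (d : nat) (v : 'cV[R]_d) :
  normsq v = (v^T *m v) 0 0.
Proof. by rewrite mxE; apply: eq_bigr => i _; rewrite mxE expr2. Qed.

Lemma normsq_orthogonal (R : realType) (d : nat) (T : 'M[R]_d) (v : 'cV[R]_d) :
  orthogonal_matrix T -> normsq (T *m v) = normsq v.
Proof.
move=> /mulmx1C TT.
by rewrite !normsq_mulmx trmx_mul mulmxA -(mulmxA v^T) TT mulmx1.
Qed.

Lemma normsq_shift (R : realType) (d : nat) (a b : R) (v : 'cV[R]_d) (i : 'I_d) :
  normsq (a *: v + b *: (row i 1%:M)^T) =
  a ^+ 2 * normsq v + 2 * a * b * v i 0 + b ^+ 2.
Proof.
rewrite /normsq (bigD1 i) //= [in RHS](bigD1 i) //=.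
rewrite (eq_bigr (fun j => a ^+ 2 * v j 0 ^+ 2)); last first.
  by move=> j ji; rewrite !mxE eq_sym (negPf ji) mulr0 addr0 exprMn.
by rewrite -mulr_sumr !mxE eqxx mulr1; ring.
Qed.

Lemma sqr_coord_le_normsq (R : realType) (d : nat) (v : 'cV[R]_d) (i : 'I_d) :
  v i 0 ^+ 2 <= normsq v.
Proof.
by rewrite /normsq (bigD1 i) //= lerDl sumr_ge0 // => j _; exact: sqr_ge0.
Qed.

Lemma state_eta (R : realType) (d : nat) (U : state R d) :
  U = mkstate (mass U) (momentum U) (energy U).
Proof.
rewrite /mkstate /mass /momentum /energy -!mx11_scalar.
by rewrite !vsubmxK.
Qed.

Lemma mkstateK (R : realType) (d : nat) (D : R) (m : 'cV[R]_d) (E : R) :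
  [/\ mass (mkstate D m E) = D, momentum (mkstate D m E) = m &
      energy (mkstate D m E) = E].
Proof.
rewrite /mass /momentum /energy /mkstate !(col_mxKu, col_mxKd).
by split=> //; rewrite mxE eqxx.
Qed.

Lemma mkstate_inj (R : realType) (d : nat) (D D' E E' : R) (m m' : 'cV[R]_d) :
  mkstate D m E = mkstate D' m' E' -> [/\ D = D', m = m' & E = E'].
Proof.
move=> eq; have [a b c] := mkstateK D m E; have [a' b' c'] := mkstateK D' m' E'.
by split; [rewrite -a eq | rewrite -b eq | rewrite -c eq].
Qed.

Lemma mkstateZ (R : realType) (d : nat) (k D E : R) (m : 'cV[R]_d) :
  k *: mkstate D m E = mkstate (k * D) (k *: m) (k * E).
Proof. by rewrite /mkstate !scale_col_mx !scale_scalar_mx. Qed.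

Lemma mkstateD (R : realType) (d : nat) (D E D' E' : R) (m m' : 'cV[R]_d) :
  mkstate D m E + mkstate D' m' E' = mkstate (D + D') (m + m') (E + E').
Proof. by rewrite /mkstate !add_col_mx -!raddfD. Qed.

Lemma diag_1T1_mkstate (R : realType) (d : nat) (T : 'M[R]_d) (D E : R)
    (m : 'cV[R]_d) :
  diag_1T1 T *m mkstate D m E = mkstate D (T *m m) E.
Proof.
by rewrite /diag_1T1 /mkstate !mul_block_col !mul0mx !mul1mx !(addr0, add0r).
Qed.

(** * The admissible cone *)

(** Eliminates density and velocity from the three relations and leaves one
    scalar equation for the pressure. *)
Lemma is_primitiveE (R : realType) (d : nat) (e : R -> R -> R) (D E : R)
    (m : 'cV[R]_d) (rho p : R) (v : 'cV[R]_d) :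
  eos_assumptions e -> 0 < D -> 0 < E -> normsq m < E ^+ 2 ->
  is_primitive e (mkstate D m E) (rho, v, p) <->
  [/\ 0 < p, v = (E + p)^-1 *: m, rho = rest_density D E (normsq m) p &
     enthalpy e p rho / scaled_enthalpy E (normsq m) p = D^-1].
Proof.
move=> he D0 E0 mE; rewrite /is_primitive /lorentz euclidean_norm_lt1.
rewrite euclidean_norm_sqr; set s := scaled_enthalpy E (normsq m) p.
split.
- case=> r0 v1 p0 /mkstate_inj.
  set W := (Num.sqrt _)^-1; set A := _ * W ^+ 2 => -[eD em eE].
  have x0 : 0 < E + p by exact: addr_gt0.
  have s0 : 0 < s by apply: scaled_enthalpy_gt0 => //; exact: ltW.
  have xn := lt0r_neq0 x0; have sn := lt0r_neq0 s0; have rn := lt0r_neq0 r0.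
  have xA : E + p = A by rewrite eE subrK.
  have vE : v = (E + p)^-1 *: m.
    by rewrite em xA scalerA mulVf ?scale1r // -xA.
  have We : W = (E + p) / s.
    have w : 1 - normsq v = (s / (E + p)) ^+ 2.
      rewrite vE normsqZ expr_div_n scaled_enthalpy_sqr ?ltW //.
      by field.
    by rewrite /W w sqrtr_sqr ger0_norm ?divr_ge0 ?ltW // invf_div.
  split=> //.
  + by rewrite /rest_density eD We -/s; field; rewrite xn.
  + have : E + p = rho * enthalpy e p rho * ((E + p) / s) ^+ 2.
      by rewrite -We -/A -xA.
    move=> h1; have h2 : rho * enthalpy e p rho = s ^+ 2 / (E + p).
      rewrite -[LHS](mulfK (_ : ((E + p) / s) ^+ 2 != 0)) -?h1.
        by field; rewrite xn.
      by rewrite expf_neq0 // mulf_neq0 // invr_neq0.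
    have -> : enthalpy e p rho = s ^+ 2 / (E + p) / rho by rewrite -h2; field.
    by rewrite eD We; field; rewrite ?xn ?rn ?sn.
- case=> p0 vE rE hE.
  have x0 : 0 < E + p by exact: addr_gt0.
  have s0 : 0 < s by apply: scaled_enthalpy_gt0 => //; exact: ltW.
  have xn := lt0r_neq0 x0; have sn := lt0r_neq0 s0.
  have w : 1 - normsq v = (s / (E + p)) ^+ 2.
    rewrite vE normsqZ expr_div_n scaled_enthalpy_sqr ?ltW //.
    by field.
  have r0 : 0 < rho by rewrite rE; apply: rest_density_gt0 => //; exact: ltW.
  have rs : rho = D * s / (E + p) by rewrite rE.
  rewrite w sqrtr_sqr ger0_norm ?divr_ge0 ?ltW // invf_div.
  have Dn := lt0r_neq0 D0.
  have -> : enthalpy e p rho = s / D.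
    by rewrite -[LHS](divfK sn) hE mulrC.
  split=> //.
  + by rewrite -subr_gt0 w exprn_gt0 // divr_gt0.
  + have -> : rho * (s / D) * ((E + p) / s) ^+ 2 = E + p.
      by rewrite rs; field; rewrite ?xn ?sn ?Dn.
    congr mkstate.
    * by rewrite rs; field; rewrite ?xn ?sn.
    * by rewrite vE scalerA mulfV ?scale1r.
    * by rewrite addrK.
Qed.

Lemma primitive_spec (R : realType) (d : nat) (e : R -> R -> R) (U : state R d) :
  (exists! w, is_primitive e U w) ->
  is_primitive e U (density e U, velocity e U, pressure e U).
Proof.
case=> w [Pw _]; rewrite /density /velocity /pressure -!surjective_pairing.
by apply: (@xgetPex _ (0, 0, 0) [set w | is_primitive e U w]); exists w.
Qed.

(** The computation behind both the necessity of the cone condition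
    ([b = 0]) and the Lax-Friedrichs splitting ([b] is [theta * v_i]).  Here [n]
    is $|v|^2$, and the difference of the two sides equals
    $k^2 W^2 (\rho^2 h^2 - 2 \rho h p - \rho^2)$. *)
Lemma cone_inequality (R : realType) (e : R -> R -> R) (rho p n b : R) :
  eos_assumptions e -> 0 < rho -> 0 < p -> n < 1 -> b ^+ 2 <= n ->
  let A := rho * enthalpy e p rho / (1 - n) in
  let k := 1 + b in
  [/\ 0 < k, 0 < k * A - p &
    k ^+ 2 * (rho ^+ 2 / (1 - n) + A ^+ 2 * n) + 2 * k * A * p * b + p ^+ 2
      <= (k * A - p) ^+ 2].
Proof.
move=> he r0 p0 n1 bn.
have [_] := enthalpy_bounds he p0 r0.
set H := rho * enthalpy e p rho => Hp HH A k.
have nn : 0 < 1 - n by rewrite subr_gt0.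
have b1 : `|b| < 1.
  rewrite -(@ltr_pXn2r _ 2) ?nnegrE // real_normK ?num_real // expr1n.
  exact: le_lt_trans n1.
have k0 : 0 < k by move: b1; rewrite ltr_norml => /andP[+ _]; rewrite /k; lra.
split=> //.
- rewrite subr_gt0 /A mulrA ltr_pdivlMr //.
  (* $1 - n \le 1 - b^2 = (2 - k) k$ *)
  have nk : 1 - n <= 2 * k.
    have : 1 - n <= (2 - k) * k by move: bn; rewrite /k; lra.
    have := mulr_ge0 (ltW k0) (ltW k0); lra.
  apply: (@le_lt_trans _ _ (k * (2 * p))).
    by rewrite mulrA mulrC (mulrC k) ler_wpM2r ?(ltW p0).
  by rewrite ltr_pM2l.
- rewrite -subr_ge0.
  have -> : (k * A - p) ^+ 2 - (k ^+ 2 * (rho ^+ 2 / (1 - n) + A ^+ 2 * n) +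
      2 * k * A * p * b + p ^+ 2) =
      k ^+ 2 / (1 - n) * (H ^+ 2 - (rho ^+ 2 + 2 * H * p)).
    by rewrite /A /k; field; exact: lt0r_neq0.
  by rewrite mulr_ge0 ?subr_ge0 // divr_ge0 ?sqr_ge0 ?(ltW nn).
Qed.

Lemma lorentz_gt0 (R : realType) (d : nat) (v : 'cV[R]_d) :
  normsq v < 1 -> 0 < lorentz v.
Proof.
by move=> v1; rewrite /lorentz euclidean_norm_sqr invr_gt0 sqrtr_gt0 subr_gt0.
Qed.

Lemma lorentz_sqr (R : realType) (d : nat) (v : 'cV[R]_d) :
  normsq v < 1 -> lorentz v ^+ 2 = (1 - normsq v)^-1.
Proof.
move=> v1; rewrite /lorentz euclidean_norm_sqr exprVn sqr_sqrtr //.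
by rewrite subr_ge0 ltW.
Qed.

(** Explicit description of the admissible set: the primitive variables
    disappear, and with them the implicit dependence on the equation of
    state. *)
Lemma admissible_mkstate (R : realType) (d : nat) (e : R -> R -> R) (D E : R)
    (m : 'cV[R]_d) :
  eos_assumptions e ->
  admissible d e (mkstate D m E) <->
  [/\ 0 < D, 0 < E & D ^+ 2 + normsq m < E ^+ 2].
Proof.
move=> he; split.
  case=> /primitive_spec + _; set rho := density _ _; set v := velocity _ _.
  set p := pressure _ _; rewrite /is_primitive euclidean_norm_lt1.
  case=> r0 v1 p0 /mkstate_inj [-> -> ->].
  have [] := @cone_inequality R e rho p (normsq v) 0 he r0 p0 v1.
    by rewrite expr0n normsq_ge0.
  rewrite addr0 expr1n !mul1r mulr0 addr0 => _ E0 DE.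
  rewrite lorentz_sqr //; split=> //; first by rewrite mulr_gt0 // lorentz_gt0.
  rewrite normsqZ exprMn lorentz_sqr //; apply: lt_le_trans DE.
  by rewrite ltrDl exprn_gt0.
move=> [D0 E0 DE].
have mE : normsq m < E ^+ 2.
  by apply: le_lt_trans DE; rewrite lerDr sqr_ge0.
have m0 := normsq_ge0 m.
have [p p0 Fp] := pressure_exists he D0 E0 m0 mE DE.
pose rho := rest_density D E (normsq m) p.
have ex : exists! w, is_primitive e (mkstate D m E) w.
  exists (rho, (E + p)^-1 *: m, p); split; first exact/is_primitiveE.
  move=> [[rho' v'] p'] /(is_primitiveE _ _ _ he D0 E0 mE) [p'0 -> rE Fp'].
  rewrite rE in Fp' *.
  by have <- := pressure_unique he D0 E0 m0 mE p0 p'0 Fp Fp'.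
split=> //.
have [r0 _ P0 _] := primitive_spec ex.
by have [] := enthalpy_bounds he P0 r0.
Qed.

(** * Lax-Friedrichs splitting *)

(** For $U + \theta F_i(U) = (D', m', E')$ the estimate [cone_inequality]
    becomes $E'^2 - D'^2 - |m'|^2 \ge p^2 (1 - \theta^2)$. *)
Lemma admissible_add_flux (R : realType) (d : nat) (e : R -> R -> R) (i : 'I_d)
    (U : state R d) (theta : R) :
  eos_assumptions e -> admissible d e U -> theta ^+ 2 < 1 ->
  admissible d e (U + theta *: flux e i U).
Proof.
move=> he aU th1; have := primitive_spec (proj1 aU).
rewrite /flux; set rho := density e U; set v := velocity e U.
set p := pressure e U; rewrite /is_primitive euclidean_norm_lt1.
case=> r0 v1 p0 UE.
have [mU momU _] := mkstateK (rho * lorentz v)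
  ((rho * enthalpy e p rho * lorentz v ^+ 2) *: v)
  (rho * enthalpy e p rho * lorentz v ^+ 2 - p).
rewrite -UE in mU momU.
have b2 : (theta * v i 0) ^+ 2 <= normsq v.
  rewrite exprMn (le_trans _ (sqr_coord_le_normsq v i)) // ler_piMl ?sqr_ge0 //.
  exact: ltW.
have := cone_inequality he r0 p0 v1 b2.
rewrite mU momU UE mkstateZ mkstateD lorentz_sqr //.
set A := rho * _ / _; set k := 1 + _ => -[k0 kA cone].
apply/(admissible_mkstate _ _ _ he).
have -> : A - p + theta * ((A *: v) i 0) = k * A - p by rewrite mxE /k; ring.
have -> : rho * lorentz v + theta * (rho * lorentz v * v i 0) = k * (rho * lorentz v).
  by rewrite /k; ring.
have -> : A *: v + theta *: (v i 0 *: (A *: v) + p *: (row i 1%:M)^T) =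
    (k * A) *: v + (theta * p) *: (row i 1%:M)^T.
  rewrite scalerDr !scalerA addrA -scalerDl; congr (_ *: _ + _).
  by rewrite /k; ring.
split=> //; first by rewrite !mulr_gt0 // lorentz_gt0.
apply: lt_le_trans cone.
rewrite normsq_shift exprMn [(rho * _) ^+ 2]exprMn lorentz_sqr // exprMn.
rewrite -subr_gt0.
have -> : k ^+ 2 * (rho ^+ 2 / (1 - normsq v) + A ^+ 2 * normsq v) +
  2 * k * A * p * (theta * v i 0) + p ^+ 2 -
  (k ^+ 2 * (rho ^+ 2 / (1 - normsq v)) +
   (k ^+ 2 * A ^+ 2 * normsq v + 2 * (k * A) * (theta * p) * v i 0 +
    (theta * p) ^+ 2)) = p ^+ 2 * (1 - theta ^+ 2) by ring.
by rewrite mulr_gt0 ?exprn_gt0 // subr_gt0.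
Qed.

Lemma closure_sub_boundary (T : topologicalType) (A : set T) :
  closure A `<=` A `|` boundary A.
Proof.
move=> x clx; have [Ax|nAx] := pselect (A x); [by left|right].
by split=> // /interior_subset.
Qed.

(** The state is the limit of $U + t \theta F_i(U)$ as $t \to 1^-$, and these
    are admissible. *)
Lemma closure_add_flux (R : realType) (d : nat) (e : R -> R -> R) (i : 'I_d)
    (U : state R d) (theta : R) :
  eos_assumptions e -> admissible d e U -> theta ^+ 2 <= 1 ->
  closure (admissible d e) (U + theta *: flux e i U).
Proof.
move=> he aU th1.
have cv : U + (t * theta) *: flux e i U @[t --> (1 : R)^'-] -->
    U + theta *: flux e i U.
  apply: cvgD; first exact: cvg_cst.
  apply: cvgZr_tmp.
  rewrite -[X in _ --> X]mul1r; apply: cvgM; last exact: cvg_cst.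
  exact: cvg_at_left_filter.
apply: (closed_cvg (closure (admissible d e)) _ _ _ cv); first exact: closed_closure.
near=> t; apply: subset_closure; apply: admissible_add_flux => //.
have t0 : 0 < t by near: t; apply: nbhs_left_gt.
have t1 : t < 1 by near: t; exact: nbhs_left_lt.
rewrite exprMn (le_lt_trans (ler_wpM2l (sqr_ge0 _) th1)) // mulr1.
by rewrite expr_lt1 // ltW.
Unshelve. all: by end_near.
Qed.

Theorem lemma3p4 (R : realType) (d : nat) (hd : (1 <= d <= 3)%N)
    (e : R -> R -> R) (he : eos_assumptions e)
    (U : state R d) (hU : admissible d e U) :
  (forall lambda : R, 0 < lambda -> admissible d e (lambda *: U)) /\
  (forall Td : 'M[R]_d, orthogonal_matrix Td ->
     admissible d e (diag_1T1 Td *m U)) /\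
  (forall i : 'I_d,
     ((admissible d e `|` boundary (admissible d e)) (U + flux e i U) /\
      (admissible d e `|` boundary (admissible d e)) (U - flux e i U)) /\
     (forall alpha : R, 1 < alpha ->
        admissible d e (U + alpha^-1 *: flux e i U) /\
        admissible d e (U - alpha^-1 *: flux e i U))).
Proof.
have [D0 E0 cone] :
    [/\ 0 < mass U, 0 < energy U &
      mass U ^+ 2 + normsq (momentum U) < energy U ^+ 2].
  by apply/(admissible_mkstate _ _ _ he); rewrite -state_eta.
split=> [l l0|].
  rewrite [U]state_eta mkstateZ; apply/(admissible_mkstate _ _ _ he).
  rewrite !mulr_gt0 // normsqZ !exprMn -mulrDr ltr_pM2l ?exprn_gt0 //.
split=> [T oT|i].
  rewrite [U]state_eta diag_1T1_mkstate; apply/(admissible_mkstate _ _ _ he).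
  by rewrite normsq_orthogonal.
split.
  split; apply: closure_sub_boundary.
    by rewrite -[flux e i U]scale1r; apply: closure_add_flux => //; rewrite expr1n.
  rewrite -scaleN1r; apply: closure_add_flux => //.
  by rewrite sqrrN expr1n.
move=> a a1; have a2 : a^-1 ^+ 2 < 1.
  by rewrite exprVn invf_lt1 ?exprn_egt1 // exprn_gt0 // (lt_trans ltr01).
split; first exact: admissible_add_flux.
by rewrite -scaleNr; apply: admissible_add_flux => //; rewrite sqrrN.
Qed.
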